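(* Let $X_1$ and $X_2$ be fuzzy incidence graphs such that for each $i\in\{1,2\}$ and each vertex $u$ of $X_i$, all pairs of $X_i$ incident at $u$ (i.e. all pairs of the form $(u,uv)$) have the same weight. Then the join $X_1\oplus X_2$ is a strong fuzzy incidence graph.
   Context: Fuzzy incidence graphs. All graphs are finite, simple and undirected; $\wedge$ denotes minimum. A fuzzy incidence graph (FIG) $X=(V,E,I,\varepsilon,\rho,\eta)$ consists of a nonempty finite vertex set $V$, a set $E$ of edges $xy=yx$ ($x\neq y$ in $V$), a set $I$ of (incidence) pairs $(x,xy)$ with $xy\in E$ and $x$ an endpoint of $xy$, and functions $\varepsilon:V\to(0,1]$, $\rho:E\to(0,1]$, $\eta:I\to(0,1]$ with $\rho(xy)\le\varepsilon(x)\wedge\varepsilon(y)$ for all $xy\in E$ and $\eta(x,xy)\le\varepsilon(x)\wedge\rho(xy)$ for all $(x,xy)\in I$ (vertices, edges, pairs of weight $0$ are regarded as absent). The number $\eta(x,xy)$ is the weight of the pair $(x,xy)$. Strong pairs. For $(a,ab)\in I$, an incidence path from $a$ to $ab$ in $X\setminus(a,ab)$ is a sequence $x_0=a,(x_0,x_0x_1),x_0x_1,(x_1,x_0x_1),x_1,\dots,x_k=b,(b,ab),ab$ with $k\ge2$, the vertices $x_0,\dots,x_k$ distinct, and all listed edges in $E$ and pairs in $I$; its incidence strength is the minimum weight of its pairs. $ICONN_{X\setminus(a,ab)}(a,ab)$ is the maximum incidence strength over all such paths ($0$ if there are none). The pair $(a,ab)$ is strong if $\eta(a,ab)\ge ICONN_{X\setminus(a,ab)}(a,ab)$.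 A strong fuzzy incidence graph (SFIG) is a FIG all of whose pairs are strong. Join. Let $X_i=(V_i,E_i,I_i,\varepsilon_i,\rho_i,\eta_i)$, $i=1,2$, with $V_1\cap V_2=\emptyset$. The join $X_1\oplus X_2$ is the FIG with vertex set $V_1\cup V_2$; edges $E_1\cup E_2\cup\{ab:a\in V_1,b\in V_2\}$; pairs $I_1\cup I_2$ together with $(a,ab)$ and $(b,ab)$ for all $a\in V_1,b\in V_2$. Its weights agree with those of $X_1$ and $X_2$ on the vertices, edges and pairs of $X_1$ and $X_2$, and for $a\in V_1,b\in V_2$: $\rho(ab)=\varepsilon_1(a)\wedge\varepsilon_2(b)$, $\eta(a,ab)=\varepsilon_1(a)\wedge\varepsilon_2(b)\wedge\min_{v}\eta_1(a,av)$ with the minimum over all pairs $(a,av)\in I_1$, and $\eta(b,ab)=\varepsilon_1(a)\wedge\varepsilon_2(b)\wedge\min_{v}\eta_2(b,bv)$ with the minimum over all pairs $(b,bv)\in I_2$ (a minimum over an empty set is omitted). *)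

(* Defs.v *)
From mathcomp Require Import all_boot all_order all_algebra.
From mathcomp Require Import reals.

Set Implicit Arguments.
Unset Strict Implicit.
Unset Printing Implicit Defensive.

Import Order.TTheory GRing.Theory Num.Theory.
Local Open Scope ring_scope.

(* The edge xy is given by the relation [edge x y] and the incidence pair
   (x, xy) by [inc x y], so that [inc x y] and [inc y x] stand for the two
   pairs of the edge xy.  Likewise [rho x y] is the weight of the edge xy and
   [eta x y] the weight of the pair (x, xy).  The values of rho outside the
   edges and of eta outside the pairs are irrelevant. *)
Record fig (R : realType) (V : finType) := Fig {
  edge : rel V;
  inc : rel V;
  eps : V -> R;
  rho : V -> V -> R;
  eta : V -> V -> R;
  fig_nonempty : (0 < #|V|)%N;
  edge_sym : symmetric edge;
  edge_irr : irreflexive edge;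
  inc_edge : forall x y, inc x y -> edge x y;
  eps_bounds : forall x, 0 < eps x <= 1;
  rho_sym : forall x y, edge x y -> rho x y = rho y x;
  rho_bounds : forall x y, edge x y -> 0 < rho x y <= 1;
  eta_bounds : forall x y, inc x y -> 0 < eta x y <= 1;
  rho_le : forall x y, edge x y -> rho x y <= Num.min (eps x) (eps y);
  eta_le : forall x y, inc x y -> eta x y <= Num.min (eps x) (rho x y)
}.

Section StrongPairs.
Variables (R : realType) (V : finType) (X : fig R V).

(* The incidence path x_0 = a, ..., x_k = b, (b, ab), ab is represented by
   [a] and the sequence [p] of the vertices x_1, ..., x_k.  Distinctness of
   the vertices together with k >= 2 keeps (a, ab) off the path. *)
Definition incidence_path (a b : V) (p : seq V) : bool :=
  [&& (2 <= size p)%N, last a p == b, uniq (a :: p),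
      path (fun x y => [&& edge X x y, inc X x y & inc X y x]) a p,
      edge X a b & inc X b a].

Fixpoint path_pairs (x : V) (p : seq V) : seq (V * V) :=
  if p is y :: q then (x, y) :: (y, x) :: path_pairs y q else [::].

(* The default value [eta X b a] accounts for the final pair (b, ab). *)
Definition incidence_strength (a b : V) (p : seq V) : R :=
  \big[Num.min/eta X b a]_(u <- path_pairs a p) eta X u.1 u.2.

(* As the vertices of an incidence path are distinct, the bound #|V| on the
   length of [p] excludes no path. *)
Definition ICONN (a b : V) : R :=
  \big[Num.max/0]_(p : #|V|.-bseq V | incidence_path a b p)
     incidence_strength a b p.

Definition strong_pair (a b : V) : Prop := ICONN a b <= eta X a b.

Definition SFIG : Prop := forall a b, inc X a b -> strong_pair a b.

End StrongPairs.

Section Join.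
Variables (R : realType) (V1 V2 : finType) (X1 : fig R V1) (X2 : fig R V2).

(* The disjoint union of the vertex sets is the sum type V1 + V2. *)
Implicit Types x y : V1 + V2.

Definition join_edge : rel (V1 + V2) := fun x y =>
  match x, y with
  | inl a, inl a' => edge X1 a a'
  | inr b, inr b' => edge X2 b b'
  | _, _ => true
  end.

Definition join_inc : rel (V1 + V2) := fun x y =>
  match x, y with
  | inl a, inl a' => inc X1 a a'
  | inr b, inr b' => inc X2 b b'
  | _, _ => true
  end.

Definition join_eps x : R :=
  match x with inl a => eps X1 a | inr b => eps X2 b end.

Definition join_rho x y : R :=
  match x, y with
  | inl a, inl a' => rho X1 a a'
  | inr b, inr b' => rho X2 b b'
  | inl a, inr b | inr b, inl a => Num.min (eps X1 a) (eps X2 b)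
  end.

(* Folding min from eps a /\ eps b gives exactly eps a /\ eps b when there is
   no pair at the vertex. *)
Definition join_eta x y : R :=
  match x, y with
  | inl a, inl a' => eta X1 a a'
  | inr b, inr b' => eta X2 b b'
  | inl a, inr b =>
      \big[Num.min/Num.min (eps X1 a) (eps X2 b)]_(v | inc X1 a v) eta X1 a v
  | inr b, inl a =>
      \big[Num.min/Num.min (eps X1 a) (eps X2 b)]_(v | inc X2 b v) eta X2 b v
  end.

Fact join_nonempty : (0 < #|{: V1 + V2}|)%N.
Proof. by rewrite card_sum addn_gt0 (fig_nonempty X1). Qed.

Fact join_edge_sym : symmetric join_edge.
Proof. by case=> [a|b] [a'|b'] //=; apply: edge_sym. Qed.

Fact join_edge_irr : irreflexive join_edge.
Proof. by case=> [a|b] /=; apply: edge_irr. Qed.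

Fact join_inc_edge x y : join_inc x y -> join_edge x y.
Proof. by case: x y => [a|b] [a'|b'] //=; apply: inc_edge. Qed.

Fact join_eps_bounds x : 0 < join_eps x <= 1.
Proof. by case: x => [a|b] /=; apply: eps_bounds. Qed.

Fact join_rho_sym x y : join_edge x y -> join_rho x y = join_rho y x.
Proof. by case: x y => [a|b] [a'|b'] //=; apply: rho_sym. Qed.

Let min_eps_bounds a b : 0 < Num.min (eps X1 a) (eps X2 b) <= 1.
Proof.
have /andP[a0 a1] := eps_bounds X1 a; have /andP[b0 _] := eps_bounds X2 b.
by rewrite lt_min a0 b0 ge_min a1.
Qed.

Fact join_rho_bounds x y : join_edge x y -> 0 < join_rho x y <= 1.
Proof. by case: x y => [a|b] [a'|b'] //=; apply: rho_bounds. Qed.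

Fact join_eta_bounds x y : join_inc x y -> 0 < join_eta x y <= 1.
Proof.
case: x y => [a|b] [a'|b'] /=; try exact: eta_bounds.
- have /andP[m0 m1] := min_eps_bounds a b' => _.
  rewrite (le_trans (bigmin_le_id _ _ _ _) m1) andbT.
  by apply: lt_bigmin => // v /eta_bounds/andP[].
- have /andP[m0 m1] := min_eps_bounds a' b => _.
  rewrite (le_trans (bigmin_le_id _ _ _ _) m1) andbT.
  by apply: lt_bigmin => // v /eta_bounds/andP[].
Qed.

Fact join_rho_le x y :
  join_edge x y -> join_rho x y <= Num.min (join_eps x) (join_eps y).
Proof.
case: x y => [a|b] [a'|b'] //=; try exact: rho_le.
by rewrite minC.
Qed.

Fact join_eta_le x y :
  join_inc x y -> join_eta x y <= Num.min (join_eps x) (join_rho x y).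
Proof.
case: x y => [a|b] [a'|b'] /=; try exact: eta_le.
- by move=> _; rewrite minA minxx bigmin_le_id.
- by move=> _; rewrite minCA minxx bigmin_le_id.
Qed.

Definition join : fig R (V1 + V2)%type :=
  Fig join_nonempty join_edge_sym join_edge_irr join_inc_edge
      join_eps_bounds join_rho_sym join_rho_bounds join_eta_bounds
      join_rho_le join_eta_le.

End Join.

(* Main.v *)
(** Every incidence path from [a] to [ab] starts with a pair [(a, ax)] and ends
with the pair [(b, ab)].  In the join, the weight of any pair at [a] is at most
the common weight of the pairs at [a] in its own factor, and the weight of
[(b, ab)] is at most that of the vertex [b].  These two pairs alone therefore
bound the strength of the path by the weight of [(a, ab)]. *)
Require Import Defs.
From mathcomp Require Import all_boot all_order all_algebra.
From mathcomp Require Import reals.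

Import Order.TTheory.
Local Open Scope ring_scope.

Lemma eta_le_eps {R : realType} {V : finType} {X : fig R V} {x y : V} :
  inc X x y -> eta X x y <= eps X x.
Proof. by move=> /eta_le; rewrite le_min => /andP[]. Qed.

Lemma strong_pair_ends (R : realType) (V : finType) (X : fig R V) (a b : V) :
  inc X a b ->
  (forall x, inc X a x -> Num.min (eta X a x) (eta X b a) <= eta X a b) ->
  strong_pair X a b.
Proof.
move=> ab ends; apply: bigmax_le => [|[[|x p] /= _]].
(* [ICONN] is a maximum with default 0, so the bound needs a nonnegative weight. *)
- by have /andP[/ltW] := eta_bounds ab.
- by case/and5P.
case/and5P=> _ _ _ /= /andP[/and3P[_ ax _] _] _.
apply: le_trans (ends x ax); rewrite /incidence_strength /= big_cons le_min.
(* The first pair heads the list; the last is the default of the minimum. *)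
by rewrite ge_min lexx /= ge_min bigmin_le_id orbT.
Qed.

(** Towards [V1] the weights agree by hypothesis; towards [V2] the weight is a minimum in which
    [(u, uv)] takes part. *)
Lemma join_eta_le_inl {R : realType} {V1 V2 : finType}
    {X1 : fig R V1} {X2 : fig R V2} {u v : V1} {x : V1 + V2} :
  (forall w w', inc X1 u w -> inc X1 u w' -> eta X1 u w = eta X1 u w') ->
  inc X1 u v -> inc (join X1 X2) (inl u) x ->
  eta (join X1 X2) (inl u) x <= eta X1 u v.
Proof.
move=> h uv; case: x => [w|w] /= ux; first by rewrite (h w v).
exact: bigmin_le_cond.
Qed.

Lemma join_eta_le_inr {R : realType} {V1 V2 : finType}
    {X1 : fig R V1} {X2 : fig R V2} {u v : V2} {x : V1 + V2} :
  (forall w w', inc X2 u w -> inc X2 u w' -> eta X2 u w = eta X2 u w') ->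
  inc X2 u v -> inc (join X1 X2) (inr u) x ->
  eta (join X1 X2) (inr u) x <= eta X2 u v.
Proof.
move=> h uv; case: x => [w|w] /= ux; last by rewrite (h w v).
exact: bigmin_le_cond.
Qed.

Theorem theorem3p10 (R : realType) (V1 V2 : finType)
    (X1 : fig R V1) (X2 : fig R V2)
    (h1 : forall u v w : V1, inc X1 u v -> inc X1 u w ->
            eta X1 u v = eta X1 u w)
    (h2 : forall u v w : V2, inc X2 u v -> inc X2 u w ->
            eta X2 u v = eta X2 u w) :
  SFIG (join X1 X2).
Proof.
move=> a b ab; apply: strong_pair_ends => // x ax.
case: a b ab ax => [u|u] [w|w] ab ax.
- by rewrite ge_min (join_eta_le_inl (h1 u)).
(* Both end pairs are needed for the default [eps] bound; the first alone handles each pair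
   [(u, uv)] of [X1]. *)
- rewrite [leRHS]/=; apply: le_bigmin => [|v uv].
    exact: (le_min2 (eta_le_eps ax)
      (eta_le_eps (X := join X1 X2) (x := inr w) (y := inl u) isT)).
  by rewrite ge_min (join_eta_le_inl (h1 u)).
- rewrite [leRHS]/=; apply: le_bigmin => [|v uv].
    (* The default lists the [X1] vertex first, while [a] now lies in [V2]. *)
    rewrite [leRHS]minC.
    exact: (le_min2 (eta_le_eps ax)
      (eta_le_eps (X := join X1 X2) (x := inl w) (y := inr u) isT)).
  by rewrite ge_min (join_eta_le_inr (h2 u)).
- by rewrite ge_min (join_eta_le_inr (h2 u)).
Qed.
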